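(* Let $A\in\mathbb{C}^{n\times n}$, let $m$ be the minimal polynomial of $A$ and let $l=\deg m$. For $u,v\in\mathbb{C}^n$ and $\tau\in\mathbb{C}$ put $B(\tau)=A+\tau uv^\top$ and let $p_{uv}$ be the polynomial $p_{uv}(\lambda)=m(\lambda)\cdot v^\top(\lambda-A)^{-1}u$. Then for generic $u,v\in\mathbb{C}^n$ there exist $\tau_0>0$ and differentiable functions $$\mu_1,\dots,\mu_l:\{\tau\in\mathbb{C}:|\tau|>\tau_0\}\to\mathbb{C}$$ such that (i) $\sigma(B(\tau))\setminus\sigma(A)=\{\mu_j(\tau):j=1,\dots,l\}$ for $|\tau|>\tau_0$; (ii) $\mu_j(\tau)\neq\mu_{j'}(\tau)$ for all $|\tau|>\tau_0$ and $j,j'=1,\dots,l$, $j\neq j'$; (iii) $\mu_1(\tau),\dots,\mu_{l-1}(\tau)$ tend, as $|\tau|\to\infty$, to the $l-1$ roots of the polynomial $p_{uv}$; (iv) $\mu_l(\tau)/\tau\to v^\top u$ as $|\tau|\to\infty$.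
   Context: $\sigma(X)$ denotes the spectrum (set of eigenvalues) of a square complex matrix $X$. The expression $m(\lambda)\,v^\top(\lambda-A)^{-1}u$, defined for $\lambda\notin\sigma(A)$, extends to a polynomial in $\lambda$ of degree at most $\deg m-1$; this polynomial is $p_{uv}$. A subset $\Omega\subseteq\mathbb{C}^N$ is called generic if $\Omega$ is nonempty and its complement $\mathbb{C}^N\setminus\Omega$ is contained in a (complex) algebraic set which is not $\mathbb{C}^N$. The phrase ''Let $A\in\mathbb{C}^{n\times n}$. Then for generic $u,v\in\mathbb{C}^n$ ...'' means: for every $A\in\mathbb{C}^{n\times n}$ there exists a generic subset $\Omega$ of $\mathbb{C}^{2n}$, possibly dependent on $A$, such that for all $(u,v)\in\Omega$ the stated property holds (here $\tau_0$ and the $\mu_j$ may depend on $(u,v)$). *)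

(* Defs.v *)
From HB Require Import structures.
From mathcomp Require Import all_boot all_order all_algebra.
From mathcomp Require Import all_classical all_reals all_analysis.
From mathcomp Require Export complex.
(* [mpoly] is not imported: its notations clash with those of analysis. *)
From mathcomp Require mpoly.

Set Implicit Arguments.
Unset Strict Implicit.
Unset Printing Implicit Defensive.

Import Order.TTheory GRing.Theory Num.Theory.
Import numFieldNormedType.Exports.
Local Open Scope classical_set_scope.
Local Open Scope ring_scope.
Local Open Scope complex_scope.

(* An affine algebraic subset of F^N: the common zeros of a family of
   polynomials in N variables. *)
Definition algebraic_set (F : fieldType) (N : nat) (V : set 'cV[F]_N) : Prop :=
  exists S : set (mpoly.mpoly N F),
    V = [set x | forall p, S p -> mpoly.meval (fun i => x i ord0) p = 0].

Definition generic (F : fieldType) (N : nat) (Om : set 'cV[F]_N) : Prop :=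
  Om !=set0 /\
  exists V : set 'cV[F]_N, [/\ algebraic_set V, V <> setT & ~` Om `<=` V].

Definition spectrum (F : fieldType) (n : nat) (X : 'M[F]_n) : set F :=
  [set a | eigenvalue X a].

Definition rank_one_pert (F : fieldType) (n : nat) (A : 'M[F]_n)
    (u v : 'cV[F]_n) (tau : F) : 'M[F]_n :=
  A + tau *: (u *m v^T).

Definition is_p_uv (F : fieldType) (n : nat) (A : 'M[F]_n.+1)
    (u v : 'cV[F]_n.+1) (p : {poly F}) : Prop :=
  forall a : F, ~ spectrum A a ->
    p.[a] = (mxminpoly A).[a] * (v^T *m invmx (a%:M - A) *m u) ord0 ord0.

(* The default value 0 is never used: existence is [p_uvP], and uniqueness is
   [p_uv_unique]. *)
Definition p_uv (F : fieldType) (n : nat) (A : 'M[F]_n.+1)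
    (u v : 'cV[F]_n.+1) : {poly F} :=
  xget 0 [set p | is_p_uv A u v p].

(* The neighbourhoods of infinity in the complex plane, that is, the filter of
   "|z| -> oo". *)
Definition infty_nbhs (R : realType) : set_system R[i] :=
  [set P | exists M : R, forall z : R[i], M%:C < `|z| -> P z].

Section Facts.
Variables (F : fieldType) (n : nat) (A : 'M[F]_n.+1) (u v : 'cV[F]_n.+1).
Local Notation m := (mxminpoly A).

Let p_expl : {poly F} :=
  \sum_(k < size m) \sum_(i < k)
    (m`_k * (v^T *m A ^+ i *m u) ord0 ord0) *: 'X^(k.-1 - i).

Lemma spectrum_unit (a : F) : ~ spectrum A a -> a%:M - A \in unitmx.
Proof.
move/negP; rewrite eigenvalue_root_char rootE unitmxE unitfE.
rewrite /char_poly -[_.[a]]/(horner_eval a _) -det_map_mx.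
suff -> : map_mx (horner_eval a) (char_poly_mx A) = a%:M - A by [].
apply/matrixP => i j; rewrite !mxE /horner_eval.
by rewrite hornerD hornerN hornerMn hornerX hornerC.
Qed.

Lemma is_p_uv_expl : is_p_uv A u v p_expl.
Proof.
move=> a aA; have U := spectrum_unit aA.
pose Q := \sum_(k < size m) m`_k *:
  \sum_(i < k) (a%:M : 'M[F]_n.+1) ^+ (k.-1 - i) * A ^+ i.
have QE : (a%:M - A) * Q = m.[a]%:M.
  transitivity (m.[a]%:M - horner_mx A m).
    rewrite horner_coef -[in horner_mx A m](coefK m) poly_def.
    rewrite mulr_sumr !rmorph_sum -sumrB.
    apply: eq_bigr => k _.
    rewrite -scalerAr -subrXX_comm; last exact: comm_scalar_mx.
    rewrite scalerBr /=.
    have -> : horner_mx A (m`_k *: 'X^k) = m`_k *: A ^+ k.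
      by rewrite horner_mxZ rmorphXn /= horner_mx_X.
    congr (_ - _).
    by rewrite -mul_scalar_mx scalar_mxM [(a ^+ k)%:M]rmorphXn.
  by rewrite mx_root_minpoly subr0.
have -> : m.[a] * (v^T *m invmx (a%:M - A) *m u) ord0 ord0 =
          (v^T *m Q *m u) ord0 ord0.
  rewrite (_ : Q = m.[a] *: invmx (a%:M - A)); last first.
    rewrite -[Q](mulKmx U) -[_ *m Q]/((a%:M - A) * Q) QE.
    by rewrite mul_mx_scalar.
  by rewrite -scalemxAr -scalemxAl [in RHS]mxE.
rewrite /p_expl /Q horner_sum mulmx_sumr mulmx_suml summxE.
apply: eq_bigr => k _.
rewrite horner_sum -scalemxAr -scalemxAl mxE mulmx_sumr mulmx_suml summxE.
rewrite mulr_sumr; apply: eq_bigr => i _.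
rewrite hornerZ hornerXn -rmorphXn /= -mulmxE mul_scalar_mx -scalemxAr.
by rewrite -scalemxAl [in RHS]mxE mulrCA mulrC mulrA.
Qed.

Lemma p_uvP : is_p_uv A u v (p_uv A u v).
Proof.
by apply: (@xgetPex _ 0 [set p | is_p_uv A u v p]); exists p_expl; exact: is_p_uv_expl.
Qed.

End Facts.

Lemma p_uv_unique (F : numFieldType) (n : nat) (A : 'M[F]_n.+1)
    (u v : 'cV[F]_n.+1) (p : {poly F}) :
  is_p_uv A u v p -> p = p_uv A u v.
Proof.
move=> pP; apply/eqP; rewrite -subr_eq0; set q := _ - _.
have qc0 : q * char_poly A = 0.
  set g := q * _.
  apply: (@roots_geq_poly_eq0 _ g [seq k%:R | k <- iota 0 (size g)]).
  - apply/allP => _ /mapP[k _ ->]; rewrite rootM.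
    case: (boolP (eigenvalue A k%:R)) => [|/negP kA].
      by rewrite eigenvalue_root_char => ->; rewrite orbT.
    by rewrite /root /q hornerD hornerN pP // p_uvP // subrr eqxx.
  - by rewrite map_inj_uniq ?iota_uniq//; exact: (mulrIn (oner_neq0 F)).
  - by rewrite size_map size_iota.
move/eqP: qc0; rewrite mulf_eq0 => /orP[//|].
by rewrite (negbTE (monic_neq0 (char_poly_monic A))).
Qed.

Lemma size_p_uv (F : numFieldType) (n : nat) (A : 'M[F]_n.+1)
    (u v : 'cV[F]_n.+1) :
  (size (p_uv A u v) <= degree_mxminpoly A)%N.
Proof.
rewrite -(p_uv_unique (@is_p_uv_expl F n A u v)).
apply: (leq_trans (size_sum _ _ _)); apply/bigmax_leqP => k _.
apply: (leq_trans (size_sum _ _ _)); apply/bigmax_leqP => i _.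
apply: (leq_trans (size_scale_leq _ _)); rewrite size_polyXn.
have kd : (k <= degree_mxminpoly A)%N.
  by rewrite -ltnS -size_mxminpoly ltn_ord.
apply: leq_trans kd; case: (nat_of_ord k) i => [[]//|k' i] /=.
by rewrite ltnS leq_subr.
Qed.

#[global] Instance infty_nbhs_filter (R : realType) :
  ProperFilter (@infty_nbhs R).
Proof.
split.
  move=> [M MP]; apply: (MP (`|M| + 1)%:C).
  rewrite normc_def /= expr0n addr0 sqrtr_sqr ltcR ger0_norm ?addr_ge0//.
  by rewrite (le_lt_trans (ler_norm _))// ltrDl.
split.
- by exists 0.
- move=> P Q [M MP] [N NQ]; exists (Num.max M N) => z zMN; split.
    by apply: MP; rewrite (le_lt_trans _ zMN)// lecR le_max lexx.
  by apply: NQ; rewrite (le_lt_trans _ zMN)// lecR le_max lexx orbT.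
- by move=> P Q PQ [M MP]; exists M => z /MP /PQ.
Qed.

(* Main.v *)
Require Import Defs.
From HB Require Import structures.
From mathcomp Require Import all_boot all_order all_algebra.
From mathcomp Require Import all_classical all_reals all_analysis.
From mathcomp Require Import complex separable ring.
From mathcomp Require mpoly.

(** Write [m] for the minimal polynomial of [A], [l] for its degree and [p]
    for [p_uv A u v]. Outside the spectrum of [A], the number [a] is an
    eigenvalue of [A + tau u v^T] exactly when [tau v^T (a - A)^-1 u = 1], that
    is, when [m - tau p] vanishes at [a] ([spectrum_rank_one_pert]). If [p] and
    [m] are coprime and [tau != 0], no root of [m - tau p] lies in the spectrum
    of [A], so the eigenvalues to be followed are exactly the roots of the
    monic pencil [m - tau p] ([spectrum_diff_pencil]).

    Suppose moreover that [p] has degree [l - 1] and simple roots. At a root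
    [r] of [p] the pencil has value [m(r)], independent of [tau], and a
    derivative that grows linearly in [tau]; a logarithmic derivative estimate
    ([exists_near_root]) then gives a root of the pencil at distance
    O(1/|tau|) from [r]. This accounts for [l - 1] of the [l] roots. The last
    one is read off from the sum of all roots, which is up to sign a
    coefficient of [m - tau p]: it is [tau] times the leading coefficient [v^T u] of [p], up
    to a bounded term. For large [tau] the last root is therefore far away
    and the others stay in disjoint discs, so all roots are simple.
    Differentiability comes from the identity
    [(mu(t) - mu(tau)) h(mu(t)) = (t - tau) p(mu(t))], where [h] is the product
    of the linear factors of [m - tau p] other than ['X - mu(tau)]: it gives
    continuity, because [h(mu(t))] stays away from 0, and then the limit
    [p/h] of the difference quotient ([derivable_root_branch],
    [exists_pencil_branches]).

    The three conditions on [(u, v)], on coprimality, degree and simple roots,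
    hold off the zero set of a single polynomial: the product of [v^T u] with the resultant of [p] and
    [m (p' + X p)]. To see that this polynomial is not identically zero, take
    [u] whose annihilator is generated by [m] ([exists_maximal_vec]); then the
    moments [v^T A^i u], [i < l], can be prescribed through [v], and the
    coefficients of [p] are a unitriangular function of these moments, so [p]
    can be any polynomial of degree less than [l] ([exists_moment_poly]), for
    instance a product of [l - 1] distinct linear factors, none dividing [m]. *)

Set Implicit Arguments.
Unset Strict Implicit.
Unset Printing Implicit Defensive.

Import Order.TTheory GRing.Theory Num.Theory.
Import numFieldNormedType.Exports.
Local Open Scope classical_set_scope.
Local Open Scope ring_scope.
Local Open Scope complex_scope.

(** * The resolvent polynomial as a polynomial in its moments *)

(** The polynomial part of [m] times the series [\sum_i s i / X^(i+1)]. For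
    [s i = v^T A^i u] this series is the expansion of [v^T (X - A)^-1 u] at
    infinity, whence [p_uvE]. *)
Definition moment_poly (S : nzRingType) (m : {poly S}) (s : nat -> S) : {poly S} :=
  \poly_(d < (size m).-1) \sum_(i < (size m).-1) m`_(i + d.+1) * s i.

Lemma eq_moment_poly (S : nzRingType) (m : {poly S}) s s' :
  s =1 s' -> moment_poly m s = moment_poly m s'.
Proof.
by move=> ss'; apply: eq_poly => d _; apply: eq_bigr => i _; rewrite ss'.
Qed.

Lemma map_moment_poly (S T : nzRingType) (f : {rmorphism S -> T}) (m : {poly S}) s :
  size (map_poly f m) = size m ->
  map_poly f (moment_poly m s) = moment_poly (map_poly f m) (f \o s).
Proof.
move=> sm; apply/polyP => d; rewrite coef_map !coef_poly sm.
case: ifP => _; last by rewrite raddf0.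
rewrite /= rmorph_sum; by apply: eq_bigr => i _; rewrite rmorphM coef_map.
Qed.

Lemma coef_moment_poly_last (S : nzRingType) (m : {poly S}) s :
  (1 < size m)%N -> (moment_poly m s)`_(size m).-2 = lead_coef m * s 0%N.
Proof.
rewrite coef_poly lead_coefE; case sm: (size m) => [|[|l]] //= _.
rewrite leqnn big_ord_recl add0n big1 ?addr0// => i _.
by rewrite nth_default ?mul0r// sm lift0 addSn ltnS ltn_addl.
Qed.

(** With the coefficients of [q] listed from the top degree down, the matrix
    of the map from moments to coefficients is triangular with the leading
    coefficient of [m] on its diagonal. *)
Lemma moment_poly_surj (F : fieldType) (m q : {poly F}) :
  m \is monic -> (size q < size m)%N -> exists s, moment_poly m s = q.
Proof.
move=> mm; set l := (size m).-1.
have sm : size m = l.+1 by rewrite prednK// size_poly_gt0 monic_neq0.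
rewrite sm ltnS => sq.
pose T := \matrix_(e < l, i < l) m`_(i + (rev_ord e).+1).
have T1 : T \in unitmx.
  rewrite unitmxE det_trig.
    rewrite big1 ?unitr1// => i _; rewrite mxE /= subnSK// subnKC ?(ltnW (ltn_ord i))//.
    by move: mm; rewrite monicE lead_coefE sm => /eqP.
  apply/is_trig_mxP => e i ei; rewrite mxE nth_default//= sm subnSK//.
  by rewrite addnBA ?(ltnW (ltn_ord e))// ltn_subRL ltn_add2r.
pose c := invmx T *m \col_e q`_(rev_ord e).
exists (fun k => if insub k is Some i then c i 0 else 0).
apply/polyP => d; rewrite coef_poly -/l; case: ifPn => dl; last first.
  by rewrite nth_default// (leq_trans sq)// leqNgt.
have := congr1 (fun M : 'cV_l => M (rev_ord (Ordinal dl)) 0) (mulKVmx T1 (\col_e q`_(rev_ord e))).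
rewrite !mxE rev_ordK /= => <-; apply: eq_bigr => i _.
by rewrite mxE rev_ordK valK.
Qed.

Lemma p_uvE (F : numFieldType) (n : nat) (A : 'M[F]_n.+1) (u v : 'cV[F]_n.+1) :
  p_uv A u v =
  moment_poly (mxminpoly A) (fun i => (v^T *m A ^+ i *m u) ord0 ord0).
Proof.
rewrite -(p_uv_unique (@is_p_uv_expl _ _ A u v)) /moment_poly.
set m := mxminpoly A; pose s i : F := (v^T *m A ^+ i *m u) ord0 ord0.
have sm : size m = (degree_mxminpoly A).+1 by exact: size_mxminpoly.
rewrite sm /=; set l := degree_mxminpoly A in sm *.
apply/polyP => d; rewrite coef_poly coef_sum.
transitivity (\sum_(k < l.+1) \sum_(i < l | (i < k)%N) m`_k * s i * (d == k.-1 - i)%N%:R).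
  apply: eq_bigr => k _; rewrite coef_sum -(big_ord_widen l (fun i => m`_k * s i * (d == k.-1 - i)%N%:R)).
    by apply: eq_bigr => i _; rewrite coefZ coefXn.
  by rewrite -ltnS.
rewrite (exchange_big_dep xpredT)//=.
transitivity (\sum_(i < l) m`_(i + d.+1) * s i).
  apply: eq_bigr => i _.
  have [lt|ge] := ltnP (i + d.+1) l.+1.
    rewrite (bigD1 (Ordinal lt)) /=; last by rewrite addnS ltnS leq_addr.
    rewrite {2}addnS /= addKn eqxx mulr1.
    rewrite big1 ?addr0// => k /andP[ik kn].
    have [dE|_] := d =P (k.-1 - i)%N; last by rewrite mulr0.
    case/eqP: kn; apply: val_inj => /=; rewrite dE.
    by case: (nat_of_ord k) ik => // k' ik' /=; rewrite addnS subnKC.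
  rewrite big1 ?nth_default ?mul0r ?sm// => k ik.
  have [dE|_] := d =P (k.-1 - i)%N; last by rewrite mulr0.
  move: ge; rewrite dE addnS; case: (nat_of_ord k) ik (ltn_ord k) => // k' ik' kl /=.
  by rewrite subnKC// leqNgt kl.
case: ltnP => // ld; apply: big1 => i _.
by rewrite nth_default ?mul0r// sm addnS ltnS (leq_trans ld)// leq_addl.
Qed.

(** * Vectors whose annihilator is the minimal polynomial *)

(** A finite union of proper subspaces does not cover the whole space. *)
Lemma exists_nonkernel_vec (F : closedFieldType) (n k : nat) (Ms : seq 'M[F]_(n, k)) :
  0 \notin Ms -> exists u : 'cV_k, forall M, M \in Ms -> M *m u != 0.
Proof.
move=> M0.
(* On the moment curve [(1, t, t^2, ...)] each coordinate of [M *m u] is a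
   polynomial in [t], and some coordinate is a nonzero one. *)
pose p (M : 'M[F]_(n, k)) : {poly F} :=
  if [pick i | row i M != 0] is Some i then rVpoly (row i M) else 1.
have /closed_nonrootP[t] : \prod_(M <- Ms) p M != 0.
  rewrite prodf_seq_neq0; apply/allP => M _ /=; rewrite /p.
  case: pickP => [i|_]; last exact: oner_neq0.
  by apply: contraNneq => rM; rewrite -[row i M]rVpolyK rM linear0.
rewrite /root horner_prod prodf_seq_neq0 => /allP /= pt.
exists (\col_j t ^+ j) => M MMs.
move: (pt _ MMs); apply: contra_neq => Mu0; rewrite /p.
case: pickP => [i _|M00]; last first.
  case/negP: M0; rewrite (_ : 0 = M)//; apply/row_matrixP => i.
  by rewrite row0; apply/esym/eqP/negbFE/M00.
have := congr1 (fun N : 'cV_n => N i 0) Mu0; rewrite !mxE => <-.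
rewrite (horner_coef_wide _ (size_poly _ _)); apply: eq_bigr => j _.
by rewrite coef_rVpoly_ord !mxE.
Qed.

(** It suffices that [u] is killed by none of the matrices [(m / (X - a))(A)],
    for [a] a root of [m]: a proper divisor of [m] divides one of the
    polynomials [m / (X - a)], so the generator of the annihilator of [u],
    which divides [m], is [m] itself. *)
Lemma exists_maximal_vec (F : closedFieldType) (n : nat) (A : 'M[F]_n.+1) :
  exists u : 'cV_n.+1,
    forall g, horner_mx A g *m u = 0 -> mxminpoly A %| g.
Proof.
set m := mxminpoly A; have m0 : m != 0 by rewrite monic_neq0 ?mxminpoly_monic.
have [rs mE] := closed_field_poly_normal m.
pose Ms := [seq horner_mx A (m %/ ('X - a%:P)) | a <- rs & root m a].
have Ms0 : 0 \notin Ms.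
  apply/mapP => -[a]; rewrite mem_filter => /andP[ma _] /esym/mxminpoly_min.
  apply/negP; rewrite gtNdvdp//.
    rewrite divp_eq0 negb_or m0 size_XsubC.
    rewrite polyXsubC_eq0 /= -leqNgt.
    by rewrite (leq_trans _ (dvdp_leq m0 (_ : 'X - a%:P %| m)))// ?size_XsubC// dvdp_XsubCl.
  by rewrite size_divp ?polyXsubC_eq0// size_XsubC /= subn1 prednK// size_poly_gt0.
have [u uP] := exists_nonkernel_vec Ms0.
exists u => g gu.
have [[x y] /= xyE] := Bezoutp g m.
set d := gcdp g m in xyE.
have du : horner_mx A d *m u = 0.
  have /eqpP[[c1 c2] /= /andP[c10 c20] E] := xyE.
  apply: (scalerI c20); rewrite scaler0 scalemxAl -horner_mxZ -E horner_mxZ.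
  rewrite -scalemxAl rmorphD !rmorphM /= mx_root_minpoly mulr0 addr0.
  by rewrite -mulmxE -mulmxA gu mulmx0 scaler0.
have dm : d %| m by rewrite dvdp_gcdr.
suff : m %| d by move/dvdp_trans; apply; rewrite dvdp_gcdl.
move: (divpK dm); set k := m %/ d => kd.
have k0 : k != 0 by apply: contraNneq m0 => k0; rewrite -kd k0 mul0r.
have [sk|sk] := eqVneq (size k) 1%N.
  have /size_poly1P[c c0 kc] : size k == 1%N by rewrite sk.
  by rewrite -kd kc mul_polyC dvdpZl.
have /closed_rootP[a ka] := sk.
have ma : root m a by rewrite -kd rootM ka.
have ars : a \in rs.
  by move: ma; rewrite mE rootZ ?lead_coef_eq0// root_prod_XsubC.
have /uP : horner_mx A (m %/ ('X - a%:P)) \in Ms.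
  by apply: map_f; rewrite mem_filter ma.
case/eqP; have /dvdpP[k' k'E] : 'X - a%:P %| k by rewrite dvdp_XsubCl.
rewrite -kd k'E mulrAC mulpK ?polyXsubC_eq0// rmorphM /= -mulmxE -mulmxA.
by rewrite du mulmx0.
Qed.

(** For a maximal vector [u] the vectors [A^i u], [i < l], are linearly
    independent, so some [v] has any prescribed products with them. *)
Lemma exists_moment_poly (F : closedFieldType) (n : nat) (A : 'M[F]_n.+1) (q : {poly F}) :
  (size q < size (mxminpoly A))%N ->
  exists u v : 'cV_n.+1,
    moment_poly (mxminpoly A) (fun i => (v^T *m A ^+ i *m u) 0 0) = q.
Proof.
set m := mxminpoly A; set l := (size m).-1 => sq.
have [s sE] := moment_poly_surj (mxminpoly_monic A) sq.
have [u uP] := exists_maximal_vec A.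
pose K := \matrix_(i < l) (A ^+ i *m u)^T.
have Kfree : row_free K.
  rewrite -kermx_eq0; apply/eqP/row_matrixP => i; rewrite row0.
  have /sub_kermxP : (row i (kermx K) <= kermx K)%MS by exact: row_sub.
  move: (row i _) => x xK; apply/(can_inj rVpolyK); rewrite linear0; apply/eqP.
  have : m %| rVpoly x.
    apply: uP; apply/(can_inj trmxK); rewrite trmx0 -xK.
    rewrite [rVpoly x]poly_def rmorph_sum /= mulmx_suml linear_sum /=.
    rewrite mulmx_sum_row; apply: eq_bigr => j _.
    rewrite valK horner_mxZ rmorphXn /= horner_mx_X -scalemxAl linearZ /=.
    by rewrite rowK.
  apply: contraTT => x0; rewrite gtNdvdp//.
  by rewrite (leq_ltn_trans (size_poly _ _))// ltn_predL (leq_ltn_trans _ sq).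
exists u, (pinvmx K *m \col_(i < l) s i); rewrite -sE.
apply/polyP => d; rewrite !coef_poly; case: ifP => // _.
apply: eq_bigr => i _; congr (_ * _).
set v := pinvmx K *m _.
have <- : (K *m v) i 0 = s i by rewrite mulmxA mulmxVp// mul1mx mxE.
transitivity ((v^T *m A ^+ i *m u)^T 0 0); first by rewrite [RHS]mxE.
transitivity (row i (K *m v) 0 0); last by rewrite mxE.
by rewrite -mulmxA trmx_mul trmxK row_mul rowK.
Qed.

(** * Genericity *)

(** Specializing coefficients commutes with the resultant as long as the sizes,
    hence the shape of the Sylvester matrix, are preserved. *)
Lemma rmorph_resultant (S T : nzRingType) (f : {rmorphism S -> T}) (p q : {poly S}) :
  size (map_poly f p) = size p -> size (map_poly f q) = size q ->
  f (resultant p q) = resultant (map_poly f p) (map_poly f q).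
Proof.
move=> sp sq; rewrite /resultant /Sylvester_mx sp sq -det_map_mx map_col_mx.
by congr (\det (col_mx _ _)); apply/matrixP => i j;
  rewrite !mxE /= !rVpoly_delta !coefXnM coef_map /=; case: ifP; rewrite ?rmorph0.
Qed.

(** Replacing [p'] by [p' + X p] does not change its greatest common divisor with
    [p] but fixes its degree, also when [p] is a constant; the same degree then
    occurs for indeterminate coefficients, and [rmorph_resultant] applies. *)
Lemma separable_coprime_resultant (F : fieldType) (m p : {poly F}) :
  p != 0 ->
  (resultant p (m * (p^`() + 'X * p)) != 0) = separable_poly p && coprimep p m.
Proof.
move=> p0; rewrite resultant_eq0 -leqNgt leq_eqVlt ltnS leqn0 size_poly_eq0.
rewrite gcdp_eq0 (negbTE p0) orbF -/(coprimep _ _) coprimepMr andbC.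
by rewrite [_ + _]addrC coprimep_addl_mul separable_poly.unlock.
Qed.

Section Generic.
Import (canonicals) mpoly.
Variables (F : numClosedFieldType) (n : nat) (A : 'M[F]_n.+1).
Local Notation m := (mxminpoly A).
Local Notation l := (degree_mxminpoly A).
Local Notation N := (n.+1 + n.+1)%N.
Local Notation mp := (mpoly.mpoly N F).
Local Notation ev u v := (@mpoly.meval N F (fun i => col_mx u v i ord0)).
Local Notation moments u v := (fun i => ((v^T *m A ^+ i *m u) ord0 ord0)).
Implicit Types u v : 'cV[F]_n.+1.

(** The moments and the resolvent polynomial for vectors of indeterminates. *)
Let s (i : nat) : mp := \sum_a \sum_b
  mpoly.mpolyC N ((A ^+ i) a b) * mpoly.mpolyX F (mpoly.mnm1 (rshift n.+1 a)) *
   mpoly.mpolyX F (mpoly.mnm1 (lshift n.+1 b)).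
Let mC : {poly mp} := map_poly (mpoly.mpolyC N (R:=F)) m.
Let pg := moment_poly mC s.

Let mpolyC_inj : injective (mpoly.mpolyC N (R:=F)).
Proof. by move=> c1 c2 /eqP; rewrite mpoly.mpolyC_eq => /eqP. Qed.

Let ev_s u v i : ev u v (s i) = (v^T *m A ^+ i *m u) ord0 ord0.
Proof.
rewrite /s raddf_sum -mulmxA mxE; apply: eq_bigr => a _.
rewrite raddf_sum !mxE big_distrr; apply: eq_bigr => b _.
rewrite /= !mpoly.mevalM mpoly.mevalC !mpoly.mevalXU col_mxEu col_mxEd.
by rewrite mulrAC mulrC mulrA.
Qed.

Let ev_mC u v : map_poly (ev u v) mC = m.
Proof.
rewrite -map_poly_comp; apply/polyP => i.
by rewrite coef_map_id0 /= ?mpoly.mevalC.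
Qed.

Let ev_pg u v : map_poly (ev u v) pg = moment_poly m (moments u v).
Proof.
rewrite map_moment_poly; last by rewrite ev_mC size_map_inj_poly.
by rewrite ev_mC; apply: eq_moment_poly => i; exact: ev_s.
Qed.

(** The polynomial is [s 0 * D] with [D] the resultant above for indeterminate
    [u] and [v]; the factor [s 0 = v^T u] is the leading coefficient of [pg]. *)
Lemma generic_moment_poly : exists P : mp,
  (exists x : 'cV_N, mpoly.meval (fun i => x i ord0) P != 0) /\
  forall u v, ev u v P != 0 ->
    let p := moment_poly m (moments u v) in
    [/\ size p = l, separable_poly p & coprimep p m].
Proof.
pose D := resultant pg (mC * (pg^`() + 'X * pg)).
have sm : size m = l.+1 by exact: size_mxminpoly.
have l0 : (0 < l)%N by exact: mxminpoly_nonconstant.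
have smC : size mC = size m.
  by rewrite size_map_inj_poly.
have mC1 : lead_coef mC = 1.
  rewrite lead_coef_map_inj //.
  by have := mxminpoly_monic A; rewrite monicE => /eqP ->.
have pgl : pg`_l.-1 = s 0%N.
  have := @coef_moment_poly_last _ mC s; rewrite smC sm mC1 mul1r; exact.
have spg : (size pg <= l)%N by rewrite (leq_trans (size_poly _ _))// smC sm.
have key u v : ev u v (s 0%N) != 0 ->
    let p := moment_poly m (moments u v) in
    size p = l /\ (ev u v D != 0) = separable_poly p && coprimep p m.
  move=> s0 p.
  have szpg : size pg = l.
    apply/eqP; rewrite eqn_leq spg /= -[leqLHS]prednK// ltnNge.
    apply: contra s0 => /leq_sizeP/(_ _ (leqnn _)); rewrite pgl => ->.
    by rewrite raddf0.
  have lpg : lead_coef pg = s 0%N by rewrite lead_coefE szpg.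
  have sp : size p = l.
    by rewrite /p -ev_pg size_map_poly_id0// lpg.
  split=> //.
  rewrite /D (rmorph_resultant (f := @mpoly.meval N F _)) ?size_map_poly_id0//.
  - rewrite ev_pg rmorphM rmorphD rmorphM /= ev_mC -deriv_map map_polyX ev_pg.
    by rewrite separable_coprime_resultant// -size_poly_eq0 sp -lt0n.
  - by rewrite lpg.
  - rewrite lead_coefM mC1 mul1r lead_coefDr.
      by rewrite lead_coefM lead_coefX mul1r lpg.
    have pg0 : pg != 0 by rewrite -size_poly_eq0 szpg -lt0n.
    by rewrite mulrC size_mulX// ltnW// ltnS lt_size_deriv.
exists (s 0%N * D); split; last first.
  move=> u v; rewrite mpoly.mevalM mulf_eq0 negb_or => /andP[s0 D0].
  by have [sp DE] := key _ _ s0; move: D0; rewrite DE => /andP[].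
(* A point where the polynomial does not vanish: [p] with the roots
   [t + k], [k < l - 1], for some [t] such that none of them is a root of [m]. *)
have [t] : exists t : F, ~~ root (\prod_(k < l.-1) (m \Po ('X + k%:R%:P))) t.
  apply/closed_nonrootP/prodf_neq0 => k _.
  by rewrite comp_poly2_eq0 ?size_XaddC// monic_neq0 ?mxminpoly_monic.
rewrite /root horner_prod => /prodf_neq0 mt.
pose rs := [seq t + k%:R | k <- iota 0 l.-1].
pose q := \prod_(a <- rs) ('X - a%:P).
have srs : size rs = l.-1 by rewrite size_map size_iota.
have urs : uniq rs.
  rewrite map_inj_uniq ?iota_uniq// => i j /addrI.
  exact: (mulrIn (oner_neq0 F)).
have qm : coprimep q m.
  rewrite /q big_seq; elim/big_ind: _ => [|x y xm ym|_ /mapP[k kl ->]].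
  - exact: coprime1p.
  - by rewrite coprimepMl xm.
  rewrite coprimep_sym coprimep_XsubC.
  have kl' : (k < l.-1)%N by move: kl; rewrite mem_iota.
  have := mt (Ordinal kl') isT; rewrite horner_comp.
  by rewrite /root !hornerE.
have sq : size q = l by rewrite size_prod_XsubC srs prednK.
have [|u [v pq]] := @exists_moment_poly F n A q; first by rewrite sq sm.
have s0 : ev u v (s 0%N) != 0.
  rewrite ev_s; have := coef_moment_poly_last (moments u v) (_ : (1 < size m)%N).
  rewrite pq sm /= => /(_ l0).
  have -> : q`_l.-1 = 1.
    by rewrite -sq -lead_coefE (monicP (monic_prod_XsubC _ _ _)).
  by have /monicP -> := mxminpoly_monic A; rewrite mul1r => <-; exact: oner_neq0.
exists (col_mx u v); have [_] := key u v s0.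
rewrite pq separable_prod_XsubC urs qm => D0.
by rewrite mpoly.mevalM mulf_neq0// D0.
Qed.
End Generic.

(** * Spectrum of a rank-one perturbation *)

(** Eigenvectors are row vectors: [x (A + tau u v^T) = a x] amounts to
    [x = tau (x u) v^T (a - A)^-1], so [x] is a multiple of [v^T (a - A)^-1],
    and multiplying by [u] gives the equation. *)
Lemma spectrum_rank_one_pert (F : fieldType) (n : nat) (A : 'M[F]_n.+1)
    (u v : 'cV[F]_n.+1) (tau a : F) :
  ~ spectrum A a ->
  spectrum (rank_one_pert A u v tau) a <->
  tau * (v^T *m invmx (a%:M - A) *m u) ord0 ord0 = 1.
Proof.
move=> /spectrum_unit U; set B := a%:M - A in U *.
have eigE x : x *m rank_one_pert A u v tau = a *: x <->
    x = (tau * (x *m u) ord0 ord0) *: (v^T *m invmx B).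
  have step : x *m rank_one_pert A u v tau = a *: x <->
      x *m B = (tau * (x *m u) ord0 ord0) *: v^T.
    rewrite /rank_one_pert /B mulmxDr mulmxBr mul_mx_scalar -scalemxAr mulmxA.
    have -> : x *m u *m v^T = (x *m u) ord0 ord0 *: v^T.
      by rewrite {1}[x *m u]mx11_scalar mul_scalar_mx.
    rewrite scalerA; set y := _ *: v^T.
    by split => [<-|<-]; rewrite addrC; [exact: addKr|exact: subrK].
  split=> [/step E|E]; first by rewrite -[LHS](mulmxK U) E -scalemxAl.
  by apply/step; rewrite {1}E -scalemxAl mulmxKV.
split=> [/eigenvalueP[x /eigE xE x0]|tau1].
  have xu0 : (x *m u) ord0 ord0 != 0.
    by apply: contraNneq x0 => xu0; rewrite xE xu0 mulr0 scale0r.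
  apply: (mulfI xu0); rewrite mulr1 {2}xE -scalemxAl [in RHS]mxE.
  by rewrite mulrA; congr (_ * _); rewrite mulrC.
apply/eigenvalueP; exists (v^T *m invmx B).
  by apply/eigE; rewrite tau1 scale1r.
apply: contra_eqN tau1 => /eqP ->.
by rewrite mul0mx mxE mulr0 eq_sym oner_eq0.
Qed.

Lemma spectrum_diff_pencil (F : fieldType) (n : nat) (A : 'M[F]_n.+1)
    (u v : 'cV[F]_n.+1) (p : {poly F}) (tau : F) :
  is_p_uv A u v p -> coprimep p (mxminpoly A) -> tau != 0 ->
  spectrum (rank_one_pert A u v tau) `\` spectrum A =
  [set a | root (mxminpoly A - tau *: p) a].
Proof.
move=> pP pm tau0; apply/seteqP; split => a /=.
  move=> [Ba Aa]; move/(spectrum_rank_one_pert _ _ _ Aa): Ba => E.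
  by rewrite rootE hornerD hornerN hornerZ pP// mulrCA E mulr1 subrr.
rewrite rootE hornerD hornerN hornerZ subr_eq0 => /eqP ma.
have Aa : ~ spectrum A a.
  rewrite /spectrum /= eigenvalue_root_min => rm.
  have : p.[a] = 0.
    by apply: (mulfI tau0); rewrite mulr0 -ma (rootP rm).
  move/eqP; apply/negP; apply: coprimep_root rm.
  by rewrite coprimep_sym.
split=> //; apply/(spectrum_rank_one_pert _ _ _ Aa).
have m0 : (mxminpoly A).[a] != 0.
  by apply/negP => ?; apply: Aa; rewrite /spectrum /= eigenvalue_root_min.
by apply: (mulfI m0); rewrite mulr1 mulrCA -pP.
Qed.

(** * Roots near an approximate root *)

Lemma horner_deriv_prod_XsubC (F : fieldType) (rs : seq F) (z : F) :
  z \notin rs ->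
  (\prod_(r <- rs) ('X - r%:P))^`().[z] =
  (\prod_(r <- rs) ('X - r%:P)).[z] * \sum_(r <- rs) (z - r)^-1.
Proof.
elim: rs => [|r rs IH] => [_|]; first by rewrite !big_nil -polyC1 derivC horner0 mulr0.
rewrite inE negb_or => /andP[zr /IH {}IH]; rewrite !big_cons derivM derivXsubC mul1r.
have zr0 : z - r != 0 by rewrite subr_eq0.
rewrite !hornerE IH mulrDr; congr (_ + _); last by rewrite mulrA.
by rewrite mulrAC mulfV// mul1r.
Qed.

(** If every root were farther away, each term of [f'/f = \sum_w 1/(z - w)]
    would be smaller in norm than [|f'(z)/f(z)| / deg f]. (If [f(z) = 0] take
    [w = z].) *)
Lemma exists_near_root (C : numClosedFieldType) (f : {poly C}) (z : C) :
  f^`().[z] != 0 ->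
  exists2 w, root f w & `|w - z| * `|f^`().[z]| <= (size f).-1%:R * `|f.[z]|.
Proof.
move=> f'z; have [rs fE] := closed_field_poly_normal f.
have f0 : f != 0 by apply: contraNneq f'z => ->; rewrite deriv0 horner0.
have c0 : lead_coef f != 0 by rewrite lead_coef_eq0.
have rootE w : root f w = (w \in rs) by rewrite fE rootZ ?root_prod_XsubC// -fE.
have [zrs|zrs] := boolP (z \in rs).
  exists z; rewrite ?rootE// subrr normr0 mul0r.
  by rewrite mulr_ge0 ?ler0n.
have srs : (size f).-1 = size rs by rewrite fE size_scale// size_prod_XsubC.
have f'E : f^`().[z] = f.[z] * \sum_(r <- rs) (z - r)^-1.
  rewrite {1}fE derivZ hornerZ horner_deriv_prod_XsubC// mulrA.
  by rewrite -hornerZ -fE.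
have [/hasP[w wrs le]|/hasPn far] := boolP
  (has (fun w => `|w - z| * `|f^`().[z]| <= (size f).-1%:R * `|f.[z]|) rs).
  by exists w; rewrite ?rootE.
have {}far w : w \in rs ->
    (size rs)%:R * (`|f.[z]| * `|z - w|^-1) < `|f^`().[z]|.
  move=> wrs; have wz : 0 < `|w - z|.
    by rewrite normr_gt0 subr_eq0; apply: contraNneq zrs => <-.
  rewrite -srs mulrA distrC ltr_pdivrMr// [ltRHS]mulrC.
  by rewrite real_ltNge ?realM ?realn ?normr_real// far.
suff : (size rs)%:R * `|f^`().[z]| < (size rs)%:R * `|f^`().[z]| by rewrite ltxx.
case: rs => [|w rs] in zrs srs f'E far {fE rootE} *.
  by move: f'z; rewrite f'E big_nil mulr0 eqxx.
rewrite {1}f'E normrM mulrA.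
apply: (@le_lt_trans _ _ (\sum_(r <- w :: rs) (size (w :: rs))%:R * (`|f.[z]| * `|z - r|^-1))).
  rewrite -mulr_sumr -mulrA -mulr_sumr !ler_wpM2l// ?ler0n//.
  by under [leRHS]eq_bigr do rewrite -normfV; exact: ler_norm_sum.
set K := `|f^`().[z]| in far *.
have -> : (size (w :: rs))%:R * K = \sum_(r <- w :: rs) K.
  by rewrite big_const_seq count_predT iter_addr_0 mulr_natl.
rewrite big_seq [ltRHS]big_seq.
apply: ltr_sum far; apply/hasP; exists w; rewrite ?mem_head//.
Qed.

(** * Differentiability of a simple root *)

Lemma poly_bounded (F : numDomainType) (p : {poly F}) (M : F) :
  exists2 B : F, 0 <= B & forall z, `|z| <= M -> `|p.[z]| <= B.
Proof.
elim/poly_ind: p => [|p c [B B0 IH]].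
  by exists 0 => // z _; rewrite horner0 normr0.
exists (B * `|M| + `|c|) => [|z zM]; first by rewrite addr_ge0// mulr_ge0.
rewrite hornerMXaddC (le_trans (ler_normD _ _))// lerD2r normrM.
by rewrite ler_pM ?IH// (@ger0_norm _ M)// (le_trans (normr_ge0 z)).
Qed.

Lemma horner_cvg (K : numFieldType) (T : Type) (Fi : set_system T) {FF : Filter Fi}
   (p : {poly K}) (f : T -> K^o) (a : K) :
  f @ Fi --> (a : K^o) -> p.[f x] @[x --> Fi] --> (p.[a] : K^o).
Proof.
move=> fa; elim/poly_ind: p => [|p c IH].
  under eq_fun do rewrite horner0; rewrite horner0; exact: cvg_cst.
under eq_fun do rewrite hornerMXaddC; rewrite hornerMXaddC.
by apply: cvgD; [exact: cvgM|exact: cvg_cst].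
Qed.

(** The bounds with [d] and [M] make the branch continuous: they keep the other
    factors of the pencil away from 0 and [p] bounded along it. *)
Lemma derivable_root_branch (K : numFieldType) (m p : {poly K}) (mu : K^o -> K^o)
    (tau : K) (ws : seq K) (d M : K) :
  0 < d ->
  m - tau *: p = ('X - (mu tau)%:P) * \prod_(w <- ws) ('X - w%:P) ->
  (\forall t \near (tau : K^o),
     [/\ root (m - t *: p) (mu t), `|mu t| <= M
       & forall w, w \in ws -> d <= `|mu t - w|]) ->
  derivable mu tau 1.
Proof.
move=> d0; set h := \prod_(w <- ws) _ => qE H.
have hd t : (forall w, w \in ws -> d <= `|mu t - w|) -> d ^+ size ws <= `|h.[mu t]|.
  move=> wd; rewrite /h horner_prod normr_prod -(count_predT ws) -iter_mulr_1.
  rewrite -big_const_seq big_seq [leRHS]big_seq.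
  by apply: ler_prod => w /wd dw; rewrite hornerXsubC dw ltW.
have ds0 : 0 < d ^+ size ws by rewrite exprn_gt0.
(* Subtract the pencil at [t] from the pencil at [tau], both taken at [mu t]. *)
have key t : root (m - t *: p) (mu t) ->
    (mu t - mu tau) * h.[mu t] = (t - tau) * p.[mu t].
  move=> /rootP mt; have := congr1 (fun q => q.[mu t]) qE.
  rewrite hornerM hornerXsubC => <-; rewrite -[LHS]subr0 -mt !hornerE.
  by ring.
have [B B0 pB] := poly_bounded p M.
have mu_cont : mu t @[t --> (tau : K^o)] --> (mu tau : K^o).
  apply/(@cvgrPdist_le _ K^o _ (nbhs (tau : K^o)) _) => e e0; near=> t.
  have [rt tM wd] : [/\ root (m - t *: p) (mu t), `|mu t| <= M
       & forall w, w \in ws -> d <= `|mu t - w|] by near: t.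
  rewrite -(ler_pM2r ds0) distrC.
  apply: (@le_trans _ _ (`|mu t - mu tau| * `|h.[mu t]|)); first by rewrite ler_wpM2l// hd.
  rewrite -normrM key// normrM.
  apply: (@le_trans _ _ (`|t - tau| * (B + 1))).
    by rewrite ler_wpM2l// (le_trans (pB _ tM))// lerDl.
  rewrite -ler_pdivlMr ?ltr_wpDl// distrC; near: t.
  apply: (@cvgr_dist_le _ _ _ (nbhs (tau : K^o)) _ id) => //.
  by rewrite divr_gt0 ?mulr_gt0// ltr_wpDl.
have htau : h.[mu tau] != 0.
  have [_ _ /hd] := nbhs_singleton H.
  by move/(lt_le_trans ds0); rewrite normr_gt0.
have shift_cvg : (h0 *: (1 : K^o) + (tau : K^o)) @[h0 --> (0 : K)^'] --> (tau : K^o).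
  apply: cvg_within_filter.
  have E : (fun h0 : K => h0 *: (1 : K^o) + (tau : K^o)) = (fun h0 => h0 + tau).
    by apply/funext => h0; rewrite [_ *: _]mulr1.
  rewrite E; have : ((id : K^o -> K^o) \o shift (tau : K^o)) @ (0 : K^o) --> (tau : K^o).
    by rewrite cvg_comp_shift add0r; exact: cvg_id.
  by [].
have mu_shift := cvg_comp _ _ shift_cvg mu_cont.
apply/cvg_ex; exists (p.[mu tau] / h.[mu tau]).
apply: (@cvg_trans _ ((p.[mu (h0 *: 1 + tau)] / h.[mu (h0 *: 1 + tau)] : K^o) @[h0 --> (0 : K)^'])); last first.
  by apply: cvgM; [|apply: cvgV => //]; apply: horner_cvg.
apply: near_eq_cvg; near=> h0.
have [rt _ wd] : [/\ root (m - (h0 *: (1 : K^o) + (tau : K^o)) *: p) (mu (h0 *: 1 + tau)),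
    `|mu (h0 *: 1 + tau)| <= M
    & forall w, w \in ws -> d <= `|mu (h0 *: 1 + tau) - w|].
  by near: h0; exact: (shift_cvg _ H).
have h0n : h0 != 0 by near: h0; exact: nbhs_dnbhs_neq.
have ht : h.[mu (h0 *: 1 + tau)] != 0.
  by move: (hd _ wd) => /(lt_le_trans ds0); rewrite normr_gt0.
apply: (canLR (mulfK ht)); rewrite -scalerAl [(mu \o _) _ - _]/(mu (h0 *: 1 + tau) - mu tau).
by rewrite key// addrK [h0%:A]mulr1 [_ *: _]mulrA mulVf// mul1r.
Unshelve. all: by end_near.
Qed.

(** * Neighbourhoods of infinity *)

Lemma near_norm_gt (K : numFieldType) (a t : K) :
  a < `|t| -> \forall s \near (t : K^o), a < `|s|.
Proof. by move=> at_; apply: (@cvgr_norm_gt _ K^o _ (nbhs (t : K^o)) _ id t cvg_id _ at_). Qed.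

Lemma near_all (T : Type) (I : eqType) (Fi : set_system T) {FF : Filter Fi}
    (s : seq I) (P : I -> T -> Prop) :
  (forall i, i \in s -> \forall x \near Fi, P i x) ->
  \forall x \near Fi, forall i, i \in s -> P i x.
Proof.
elim: s => [|i s IH] H; first by near=> x => j.
have H1 : \forall x \near Fi, forall j, j \in s -> P j x.
  by apply: IH => j js; apply: H; rewrite inE js orbT.
have H2 := H i (mem_head _ _).
near=> x => j; rewrite inE => /predU1P[->|]; first by near: x.
by move: j; near: x.
Unshelve. all: by end_near.
Qed.

Section Infinity.
Variable R : realType.
Local Notation C := R[i].

Lemma near_infty_gt (K : C) : \forall t \near @infty_nbhs R, `|K| < `|t|.
Proof. by rewrite normc_def; exists (Num.sqrt (complex.Re K ^+ 2 + complex.Im K ^+ 2)). Qed.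

Lemma near_infty_gt0 : \forall t \near @infty_nbhs R, 0 < `|t|.
Proof.
by near do apply: le_lt_trans (normr_ge0 (0 : C)) _; exact: near_infty_gt.
Unshelve. all: by end_near.
Qed.

(** Convergence at rate O(1/|t|). *)
Lemma infty_cvg (f : C -> C^o) (a K : C) :
  (\forall t \near @infty_nbhs R, `|f t - a| * `|t| <= K) ->
  f @ @infty_nbhs R --> (a : C^o).
Proof.
move=> fK; apply/cvgrPdist_le => e e0; near=> t.
have t0 : 0 < `|t| by near: t; exact: near_infty_gt0.
rewrite -(ler_pM2r t0) distrC.
have ft : `|f t - a| * `|t| <= K by near: t.
have K0 : 0 <= K by rewrite (le_trans _ ft)// mulr_ge0.
rewrite (le_trans ft)// mulrC -ler_pdivrMr//.
rewrite -[leLHS]ger0_norm ?divr_ge0// ?(ltW e0)// ltW//.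
by near: t; exact: near_infty_gt.
Unshelve. all: by end_near.
Qed.

Lemma infty_cvg_near (f : C -> C^o) (a e : C) : 0 < e ->
  f @ @infty_nbhs R --> (a : C^o) -> \forall t \near @infty_nbhs R, `|a - f t| <= e.
Proof. by move=> e0 /cvgrPdist_le/(_ _ e0). Qed.

End Infinity.

(** * The roots of a linear pencil of polynomials at infinity *)

Lemma seq_separation (K : numDomainType) (s : seq K) :
  exists2 d : K, 0 < d & forall x, x \in s -> x != 0 -> d <= `|x|.
Proof.
elim: s => [|y s [d d0 IH]]; first by exists 1.
have [->|y0] := eqVneq y 0.
  by exists d => // x; rewrite inE => /predU1P[->|/IH//]; rewrite eqxx.
have [dy|yd] := real_leP (gtr0_real d0) (normr_real y).
  by exists d => // x; rewrite inE => /predU1P[->|/IH].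
exists `|y|; rewrite ?normr_gt0// => x.
by rewrite inE => /predU1P[->//|xs x0]; rewrite (le_trans (ltW yd)) ?IH.
Qed.

Section Branches.
Variables (R : realType) (m p : {poly R[i]}) (rs : seq R[i]).
Local Notation C := R[i].
Hypotheses (mM : m \is monic) (sm : size m = (size p).+1).
Hypotheses (psep : separable_poly p).
Hypotheses (pE : p = lead_coef p *: \prod_(r <- rs) ('X - r%:P)).

Let p0 : p != 0. Proof. exact: separable_poly_neq0. Qed.
Let c0 : lead_coef p != 0. Proof. by rewrite lead_coef_eq0. Qed.
Let srs : size p = (size rs).+1.
Proof. by rewrite pE size_scale// size_prod_XsubC. Qed.
Let urs : uniq rs.
Proof.
rewrite -separable_prod_XsubC; move: psep; rewrite {1}pE.
by rewrite (eqp_separable (eqp_scale _ c0)).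
Qed.
Let root_p r : r \in rs -> root p r.
Proof. by rewrite pE rootZ// root_prod_XsubC. Qed.
Let p'r r : r \in rs -> p^`().[r] != 0.
Proof.
move/root_p; apply: coprimep_root.
by move: psep; rewrite separable_poly.unlock.
Qed.

Let size_pencil t : size (m - t *: p) = size m.
Proof. by rewrite size_polyDl// size_polyN sm ltnS size_scale_leq. Qed.
Let pencil_monic t : m - t *: p \is monic.
Proof.
by rewrite monicE lead_coefDl ?(monicP mM)// size_polyN sm ltnS size_scale_leq.
Qed.

(** The bound of [exists_near_root] at [r], once the derivative of the pencil
    there exceeds half of its dominant term [t * p'(r)]. *)
Let K r : C := (size m).-1%:R * `|m.[r]| / (`|p^`().[r]| / 2).
(** Several roots may satisfy the condition for small [t]; only large [t], where
    one exists, matter below. *)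
Let branch (r : C) (t : C) : C :=
  xget r [set w | root (m - t *: p) w /\ `|w - r| * `|t| <= K r].

Let branchP r : r \in rs ->
  \forall t \near @infty_nbhs R,
    root (m - t *: p) (branch r t) /\ `|branch r t - r| * `|t| <= K r.
Proof.
move=> rrs; have p'0 := p'r rrs.
have hp : 0 < `|p^`().[r]| / 2 by rewrite divr_gt0// normr_gt0.
near=> t.
have fr : (m - t *: p).[r] = m.[r].
  by rewrite !hornerE (rootP (root_p rrs)) mulr0 subr0.
have f'r : `|t| * (`|p^`().[r]| / 2) <= `|(m - t *: p)^`().[r]|.
  rewrite derivB derivZ hornerD hornerN hornerZ distrC (le_trans _ (lerB_dist _ _))//.
  rewrite normrM lerBrDr -lerBrDl -mulrBr.
  rewrite (_ : `|p^`().[r]| - _ = `|p^`().[r]| / 2); last by field.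
  rewrite -ler_pdivrMr// -[leLHS]ger0_norm ?divr_ge0 ?(ltW hp)// ltW//.
  by near: t; exact: near_infty_gt.
have t0 : 0 < `|t| by near: t; exact: near_infty_gt0.
have [|w rw wr] := @exists_near_root _ (m - t *: p) r.
  by rewrite -normr_gt0 (lt_le_trans _ f'r)// mulr_gt0.
apply: (@xgetPex _ r [set w | root (m - t *: p) w /\ `|w - r| * `|t| <= K r]).
exists w; split => //; rewrite ler_pdivlMr// -fr -(size_pencil t) -mulrA.
by rewrite (le_trans _ wr)// ler_wpM2l.
Unshelve. all: by end_near.
Qed.

Let branch_cvg r : r \in rs -> branch r @ @infty_nbhs R --> (r : C^o).
Proof.
move=> /branchP rr; apply: (@infty_cvg _ _ _ (K r)).
by apply: filterS rr => t [].
Qed.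

Let branch_near d : 0 < d ->
  \forall t \near @infty_nbhs R, forall r, r \in rs ->
    root (m - t *: p) (branch r t) /\ `|branch r t - r| <= d.
Proof.
move=> d0; apply: near_all => r rrs; near=> t; split.
  by have [] : root (m - t *: p) (branch r t) /\ `|branch r t - r| * `|t| <= K r
    by near: t; exact: branchP.
rewrite distrC; near: t; apply: infty_cvg_near d0 _; exact: branch_cvg.
Unshelve. all: by end_near.
Qed.

(** The sum of all roots of the pencil, by Vieta, minus those near [rs]. *)
Let last_branch (t : C) : C :=
  t * lead_coef p - m`_(size rs) - \sum_(r <- rs) branch r t.

Let last_branch_cvg : last_branch t / t @[t --> @infty_nbhs R] --> (lead_coef p : C^o).
Proof.
apply: (@infty_cvg _ _ _ (`|m`_(size rs)| + \sum_(r <- rs) (`|r| + 1))).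
near=> t.
have t1 : t != 0 by rewrite -normr_gt0; near: t; exact: near_infty_gt0.
rewrite -normrM mulrBl divfK// /last_branch.
rewrite (_ : _ - _ = - (m`_(size rs) + \sum_(r <- rs) branch r t)); last by ring.
rewrite normrN (le_trans (ler_normD _ _))// lerD2l (le_trans (ler_norm_sum _ _ _))//.
rewrite big_seq [leRHS]big_seq ler_sum// => r rrs.
rewrite -[in leLHS](subrK r (branch r t)) addrC (le_trans (ler_normD _ _))// lerD2l.
have H : forall r, r \in rs ->
    root (m - t *: p) (branch r t) /\ `|branch r t - r| <= 1.
  by near: t; exact: branch_near.
by have [] := H r rrs.
Unshelve. all: by end_near.
Qed.

Let last_branch_near (D : C) : 0 <= D ->
  \forall t \near @infty_nbhs R, D <= `|last_branch t|.
Proof.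
move=> D0; have h0 : 0 < `|lead_coef p| / 2 by rewrite divr_gt0 ?normr_gt0.
near=> t.
have t0 : 0 < `|t| by near: t; exact: near_infty_gt0.
have ct : `|lead_coef p - last_branch t / t| <= `|lead_coef p| / 2.
  near: t; apply: (@infty_cvg_near _ (fun t => last_branch t / t) _ _ h0).
  exact: last_branch_cvg.
have : `|lead_coef p| / 2 <= `|last_branch t / t|.
  have := le_trans (lerB_dist (lead_coef p) (last_branch t / t)) ct.
  rewrite lerBlDr -lerBlDl; apply: le_trans.
  by rewrite (_ : _ - _ = `|lead_coef p| / 2)//; by field.
rewrite normrM normfV ler_pdivlMr//; apply: le_trans.
rewrite mulrC -ler_pdivrMr// -[leLHS]ger0_norm ?divr_ge0 ?(ltW h0)// ltW//.
by near: t; exact: near_infty_gt.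
Unshelve. all: by end_near.
Qed.

Let pencil_factor t (bs : seq C) : bs = [seq branch r t | r <- rs] ->
  (forall r, r \in rs -> root (m - t *: p) (branch r t)) -> uniq bs ->
  m - t *: p = ('X - (last_branch t)%:P) * \prod_(w <- bs) ('X - w%:P).
Proof.
move=> bsE rb ub; have sbs : size bs = size rs by rewrite bsE size_map.
have /dvdpP[g gE] : \prod_(w <- bs) ('X - w%:P) %| m - t *: p.
  apply: uniq_roots_dvdp; last by rewrite uniq_rootsE.
  by apply/allP => w; rewrite bsE => /mapP[r rrs ->]; exact: rb.
have gM : g \is monic.
  by rewrite -(monicMr _ (monic_prod_XsubC bs xpredT id)) -gE.
have sg : size g = 2%N.
  have := size_pencil t; rewrite gE size_monicM ?monic_neq0 ?monic_prod_XsubC//.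
  by rewrite size_prod_XsubC sbs sm srs addnS /= => /eqP; rewrite -[eqbRHS]add2n eqn_add2r => /eqP.
have [w gw] : exists w, g = 'X - w%:P.
  exists (- g`_0); apply/polyP => i.
  rewrite coefB coefX coefC; case: i => [|[|i]].
  - by rewrite sub0r opprK.
  - by rewrite subr0 -(monicP gM) lead_coefE sg.
  - by rewrite subr0 nth_default// sg.
have := coefPn_prod_XsubC (ps := w :: bs) isT.
rewrite big_cons -gw -gE /= sbs coefB coefZ big_cons.
have -> : p`_(size rs) = lead_coef p by rewrite lead_coefE srs.
rewrite /last_branch -(big_map (branch^~ t) xpredT id) -bsE => E.
rewrite gE gw; have -> : w = - (m`_(size rs) - t * lead_coef p) - \sum_(b <- bs) b by rewrite E; ring.
by congr (('X - _%:P) * _); ring.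
Qed.

(** The same [tau0] serves all [t], and the separation of the branches is
    uniform in [t]: this is what [derivable_root_branch] needs, since it compares
    a branch at [t'] with the other branches at a nearby [t]. *)
Lemma exists_pencil_branches :
  exists2 tau0 : R, 0 < tau0 & exists mu : nat -> C^o -> C^o,
  [/\ forall j, (j <= size rs)%N -> forall t : C, tau0%:C < `|t| -> derivable (mu j) t 1,
      forall t : C, tau0%:C < `|t| ->
        m - t *: p = \prod_(w <- [seq mu j t | j <- iota 0 (size rs).+1]) ('X - w%:P),
      forall t : C, tau0%:C < `|t| -> uniq [seq mu j t | j <- iota 0 (size rs).+1],
      forall j, (j < size rs)%N -> mu j t @[t --> @infty_nbhs R] --> (rs`_j : C^o)
    & mu (size rs) t / t @[t --> @infty_nbhs R] --> (lead_coef p : C^o)].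
Proof.
have [e e0 eP] := seq_separation [seq r - r' | r <- rs, r' <- rs].
(* A third of a lower bound of the gaps: the discs of radius [d] around the roots of [p] are then
   at distance at least [d] from each other. *)
pose d := e / 3; have d0 : 0 < d by rewrite divr_gt0.
have e3 : e = d + d + d by rewrite /d; field.
have sep r r' : r \in rs -> r' \in rs -> r != r' -> d + d + d <= `|r - r'|.
  move=> rrs r'rs rr'; rewrite -e3 eP ?subr_eq0//.
  by apply/allpairsP; exists (r, r').
(* Outside the disc of radius [D] a point is at distance at least [d] from
   all these discs. *)
pose D := d + d + \sum_(r <- rs) `|r|.
have D0 : 0 <= D by rewrite !addr_ge0 ?(ltW d0)// sumr_ge0.
have : \forall t \near @infty_nbhs R,
    (forall r, r \in rs -> root (m - t *: p) (branch r t) /\ `|branch r t - r| <= d) /\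
    D <= `|last_branch t|.
  near=> t; split; first by near: t; exact: branch_near.
  by near: t; exact: last_branch_near.
move=> [M MP]; pose tau0 := Num.max M 1.
have tauM (t : C) : tau0%:C < `|t| -> M%:C < `|t|.
  by apply: le_lt_trans; rewrite lecR le_max lexx.
have {MP} tP (t : C) (ht : tau0%:C < `|t|) := MP t (tauM t ht).
have far_last (t t' : C) r : tau0%:C < `|t| -> tau0%:C < `|t'| -> r \in rs ->
    d <= `|branch r t' - last_branch t|.
  move=> /tP[_ lt] /tP[bt' _] rrs; have [_ br] := bt' _ rrs.
  rewrite distrC (le_trans _ (lerB_dist _ _))// lerBrDr (le_trans _ lt)//.
  have rb : `|branch r t'| <= `|r| + d.
    by rewrite -[branch r t'](subrK r) addrC (le_trans (ler_normD _ _))// lerD2l.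
  rewrite /D -addrA lerD2l (le_trans rb)// [leLHS]addrC lerD2l.
  by rewrite (big_rem r)//= lerDl sumr_ge0.
have far_branch (t t' : C) r r' : tau0%:C < `|t| -> tau0%:C < `|t'| ->
    r \in rs -> r' \in rs -> r != r' -> d <= `|branch r t' - branch r' t|.
  move=> /tP[bt _] /tP[bt' _] rrs r'rs rr'.
  have [_ br] := bt' _ rrs; have [_ br'] := bt _ r'rs.
  have := sep _ _ rrs r'rs rr'.
  rewrite (_ : r - r' = (branch r t' - branch r' t) + (branch r' t - r') - (branch r t' - r)); last by ring.
  move=> /le_trans /(_ (ler_normB _ _)) /le_trans /(_ (lerD (ler_normD _ _) br)).
  by rewrite lerD2r => /le_trans /(_ (lerD (lexx _) br')); rewrite lerD2r.
have uniq_branch (t : C) : tau0%:C < `|t| -> uniq [seq branch r t | r <- rs].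
  move=> ht; rewrite map_inj_in_uniq// => r r' rrs r'rs E; apply/eqP/negPn/negP => rr'.
  have := far_branch t t r r' ht ht rrs r'rs rr'.
  by rewrite E subrr normr0 => /(lt_le_trans d0); rewrite ltxx.
have factor (t : C) (ht : tau0%:C < `|t|) := pencil_factor (erefl _)
  (fun r rrs => proj1 ((tP t ht).1 r rrs)) (uniq_branch t ht).
have d_branch r (t : C) : r \in rs -> tau0%:C < `|t| ->
    derivable (branch r : C^o -> C^o) t 1.
  move=> rrs ht.
  apply: (@derivable_root_branch _ m p (branch r : C^o -> C^o) t
    (last_branch t :: [seq branch r' t | r' <- rem r rs]) d (`|r| + d)) => //.
    rewrite factor// big_cons !big_map (perm_big _ (perm_to_rem rrs)) big_cons /=.
    by rewrite mulrCA.
  have : \forall t' \near (t : C^o), tau0%:C < `|t'|.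
    exact: near_norm_gt.
  apply: filterS => t' ht'.
  have [rb br] := (tP t' ht').1 r rrs; split => //.
    by rewrite -[branch r t'](subrK r) addrC (le_trans (ler_normD _ _))// lerD2l.
  move=> w; rewrite inE => /predU1P[->|/mapP[r']]; first exact: far_last.
  rewrite (rem_filter _ urs) mem_filter => /andP[/= r'r r'rs ->].
  by apply: far_branch; rewrite // eq_sym.
pose mu j (t : C^o) : C^o := if (j < size rs)%N then branch rs`_j t else last_branch t.
have muE (t : C) : [seq mu j t | j <- iota 0 (size rs).+1] =
    rcons [seq branch r t | r <- rs] (last_branch t).
  rewrite -[in iota _ _]addn1 iotaD map_cat /= {2}/mu ltnn cats1; congr rcons.
  rewrite -[in RHS](mkseq_nth 0 rs) /mkseq -map_comp.
  by apply/eq_in_map => j; rewrite mem_iota /mu => /andP[_ ->].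
exists tau0; first by rewrite lt_max ltr01 orbT.
exists mu; split.
- move=> j; rewrite leq_eqVlt => /predU1P[->|jrs] t ht; last first.
    rewrite (_ : mu j = branch rs`_j); first by apply: d_branch => //; exact: mem_nth.
    by apply/funext => s; rewrite /mu jrs.
  rewrite (_ : mu _ = (lead_coef p *: id) - cst m`_(size rs)
      - \sum_(i < size rs) (branch rs`_i : C^o -> C^o)); last first.
    apply/funext => s; rewrite /mu ltnn /last_branch (big_nth 0) big_mkord.
    by rewrite !fctE fct_sumE mulrC.
  apply: derivableB; first apply: derivableB.
  + apply: derivableZ; exact: derivable_id.
  + exact: derivable_cst.
  + by apply: derivable_sum => i; apply: d_branch => //; exact: mem_nth.
- by move=> t ht; rewrite muE factor// -cats1 big_cat big_seq1 mulrC.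
- move=> t ht; rewrite muE rcons_uniq uniq_branch// andbT; apply/mapP => -[r rrs E].
  by have := far_last t t r ht ht rrs; rewrite E subrr normr0 => /(lt_le_trans d0); rewrite ltxx.
- move=> j jrs; rewrite /mu jrs; apply: branch_cvg; exact: mem_nth.
- by rewrite /mu ltnn; exact: last_branch_cvg.
Unshelve. all: by end_near.
Qed.

End Branches.

(** * The theorem *)

Theorem theorem4p1 (R : realType) (n : nat) (A : 'M[R[i]]_n.+1) :
  let l := degree_mxminpoly A in
  exists2 Om : set 'cV[R[i]]_(n.+1 + n.+1), generic Om &
  forall u v : 'cV[R[i]]_n.+1, Om (col_mx u v) ->
  exists2 tau0 : R, 0 < tau0 &
  exists mu : nat -> R[i]^o -> R[i]^o,
    [/\ (* differentiability *)
        forall j : nat, (1 <= j <= l)%N ->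
          forall tau : R[i], tau0%:C < `|tau| -> derivable (mu j) tau 1,
        (* (i) *)
        forall tau : R[i], tau0%:C < `|tau| ->
          spectrum (rank_one_pert A u v tau) `\` spectrum A =
          [set mu j tau | j in [set j : nat | (1 <= j <= l)%N]],
        (* (ii) *)
        forall tau : R[i], tau0%:C < `|tau| ->
          forall j j' : nat, (1 <= j <= l)%N -> (1 <= j' <= l)%N ->
            j <> j' -> mu j tau <> mu j' tau,
        (* (iii) *)
        exists r : nat -> R[i],
          [/\ p_uv A u v != 0,
              p_uv A u v =
                lead_coef (p_uv A u v) *: \prod_(1 <= j < l) ('X - (r j)%:P) &
              forall j : nat, (1 <= j < l)%N ->
                mu j tau @[tau --> @infty_nbhs R] --> (r j : R[i]^o)]
      & (* (iv) *)
        mu l tau / tau @[tau --> @infty_nbhs R] -->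
          ((v^T *m u) ord0 ord0 : R[i]^o)].
Proof.
move=> l; have [P [[x0 Px0] PP]] := generic_moment_poly A.
exists [set x | mpoly.meval (fun i => x i ord0) P != 0].
  split; first by exists x0.
  exists [set x | mpoly.meval (fun i => x i ord0) P = 0]; split.
  - exists [set P]; apply/seteqP; split => x /=; first by move=> Px _ ->.
    by move=> /(_ P erefl).
  - by move=> /seteqP[_ /(_ x0 I)] /= /eqP; rewrite (negbTE Px0).
  - by move=> x /= /negP; rewrite negbK => /eqP.
move=> u v /PP /=; rewrite -p_uvE.
set p := p_uv A u v; set m := mxminpoly A => -[sp psep pm].
have l0 : (0 < l)%N by exact: mxminpoly_nonconstant.
have sm : size m = (size p).+1 by rewrite sp size_mxminpoly.
have mM : m \is monic by exact: mxminpoly_monic.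
have [rs pE] := closed_field_poly_normal p.
have p0 : p != 0 by exact: separable_poly_neq0.
have srs : size rs = l.-1.
  by move: sp; rewrite pE size_scale ?lead_coef_eq0// size_prod_XsubC -/l => <-.
have cE : lead_coef p = (v^T *m u) ord0 ord0.
  have m1 : (1 < size m)%N by rewrite sm sp.
  have := coef_moment_poly_last (fun i => (v^T *m A ^+ i *m u) ord0 ord0) m1.
  by rewrite -p_uvE (monicP mM) mul1r expr0 mulmx1 sm /= -lead_coefE.
have [tau0 tau0_gt0 [mu [mud mup muu mur mul]]] := exists_pencil_branches mM sm psep pE.
(* Indices start at 0 in [exists_pencil_branches]. *)
exists tau0 => //; exists (fun j => mu j.-1).
have jl j : (1 <= j <= l)%N -> (j.-1 <= size rs)%N.
  by rewrite srs; case: j => //= j jl; rewrite -ltnS prednK.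
split.
- by move=> j /jl jrs tau htau; exact: mud.
- move=> tau htau.
  have tau_neq0 : tau != 0.
    by rewrite -normr_gt0; apply: lt_trans htau; rewrite ltcR.
  rewrite (spectrum_diff_pencil (@p_uvP _ _ A u v) pm tau_neq0).
  apply/seteqP; split => a /=; rewrite mup// root_prod_XsubC.
    move=> /mapP[j]; rewrite mem_iota add0n srs prednK// => jl' ->.
    by exists j.+1.
  by move=> [j /jl jrs <-]; apply: map_f; rewrite mem_iota.
- move=> tau htau j j' /[dup] /andP[j0 _] /jl jrs /[dup] /andP[j'0 _] /jl j'rs jj' E.
  apply: jj'; rewrite -(prednK j0) -(prednK j'0); congr _.+1.
  have := muu tau htau; move/uniqP => /(_ 0) inj.
  apply: (inj j.-1 j'.-1); rewrite ?inE ?size_map ?size_iota//.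
  by rewrite !(nth_map 0%N) ?size_iota// !nth_iota.
- exists (fun j => rs`_j.-1); split.
  + exact: p0.
  + by rewrite {1}pE (big_nth 0) srs big_add1.
  + move=> j /andP[j0 jl']; apply: mur; rewrite srs.
    by rewrite -ltnS !prednK.
- by rewrite -cE -srs.
Qed.
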